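(* For every $n \ge 1$ and every $0<\varepsilon<1$ there is a non-adaptive, one-sided algorithm which makes $\mathrm{poly}\big(n^{\sqrt{n\log(1/\varepsilon)}},1/\varepsilon\big)$ queries to an unknown $f:\{0,1\}^n\to\{0,1\}$ and $\varepsilon$-tests whether $f$ is intersecting versus $\varepsilon$-far from every intersecting function. The same holds with ''intersecting'' replaced by ''union-closed''.
   Context: Identify $x\in\{0,1\}^n$ with the subset $\{i: x_i=1\}$ of $[n]$. A function $f:\{0,1\}^n\to\{0,1\}$ is intersecting if whenever $f(x)=f(y)=1$ there is $i\in[n]$ with $x_i=y_i=1$. It is union-closed if whenever $f(x)=f(y)=1$ we have $f(x\cup y)=1$ (where $x\cup y$ is the coordinatewise OR). The distance between $f,g:\{0,1\}^n\to\{0,1\}$ is $\Pr_{\mathbf{x}}[f(\mathbf{x})\neq g(\mathbf{x})]$ for uniform $\mathbf{x}\in\{0,1\}^n$; $f$ is $\varepsilon$-far from a property (a class of functions) if its distance to every member is at least $\varepsilon$. An $\varepsilon$-tester for a property is a randomized algorithm with query access to $f$ that accepts with probability at least $2/3$ if $f$ has the property and rejects with probability at least $2/3$ if $f$ is $\varepsilon$-far from the property. It is one-sided if it accepts every function with the property with probability $1$, and non-adaptive if its queries do not depend on answers to earlier queries. *)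

(* Defs.v *)
From HB Require Import structures.
From mathcomp Require Import all_boot all_order all_algebra.
Set Implicit Arguments.
Unset Strict Implicit.
Unset Printing Implicit Defensive.
Import Order.TTheory GRing.Theory Num.Theory.
Local Open Scope ring_scope.

(* A point x of {0,1}^n is identified with the subset {i | x_i = 1} of [n],  *)
(* so that coordinatewise OR is set union; bool encodes the values {0,1}.    *)
Definition cube (n : nat) := {set 'I_n}.
Definition boolfun (n : nat) := cube n -> bool.

(* The case x = y is included: an intersecting f vanishes at the empty set. *)
Definition intersecting (n : nat) (f : boolfun n) : Prop :=
  forall x y : cube n, f x -> f y -> exists i : 'I_n, i \in x /\ i \in y.

Definition union_closed (n : nat) (f : boolfun n) : Prop :=
  forall x y : cube n, f x -> f y -> f (x :|: y).

Definition dist (R : realFieldType) (n : nat) (f g : boolfun n) : R :=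
  #|[set x : {set 'I_n} | f x != g x]|%:R / (2 ^ n)%N%:R.

Definition far (R : realFieldType) (n : nat) (eps : R)
    (P : boolfun n -> Prop) (f : boolfun n) : Prop :=
  forall g : boolfun n, P g -> eps <= dist R f g.

(* A deterministic, possibly adaptive, query algorithm: it either halts with *)
(* a verdict (true = accept), or queries a point and continues according to  *)
(* the answer.                                                               *)
Inductive query_tree (X : Type) : Type :=
| Halt of bool
| Query of X & (bool -> query_tree X).
Arguments Halt {X}.

Fixpoint verdict (X : Type) (t : query_tree X) (f : X -> bool) : bool :=
  match t with
  | Halt b => b
  | Query x k => verdict (k (f x)) f
  end.

Fixpoint queries (X : Type) (t : query_tree X) (f : X -> bool) : seq X :=
  match t with
  | Halt _ => [::]
  | Query x k => x :: queries (k (f x)) f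
  end.

(* A randomized query algorithm is a finitely supported probability          *)
(* distribution over deterministic ones.                                     *)
Record rand_alg (R : realFieldType) (n : nat) : Type := RandAlg {
  seed : finType;
  weight : seed -> R;
  weight_ge0 : forall w, 0 <= weight w;
  weight_sum1 : \sum_w weight w = 1;
  run : seed -> query_tree (cube n)
}.

Definition pr_accept (R : realFieldType) (n : nat) (A : rand_alg R n)
    (f : boolfun n) : R :=
  \sum_(w : seed A | verdict (run w) f) weight w.

Definition pr_reject (R : realFieldType) (n : nat) (A : rand_alg R n)
    (f : boolfun n) : R :=
  \sum_(w : seed A | ~~ verdict (run w) f) weight w.

Definition tester (R : realFieldType) (n : nat) (eps : R)
    (P : boolfun n -> Prop) (A : rand_alg R n) : Prop :=
  (forall f, P f -> 2 / 3 <= pr_accept A f) /\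
  (forall f, far eps P f -> 2 / 3 <= pr_reject A f).

Definition one_sided (R : realFieldType) (n : nat)
    (P : boolfun n -> Prop) (A : rand_alg R n) : Prop :=
  forall f, P f -> pr_accept A f = 1.

(* Once the random seed is fixed, the queried points do not depend on the    *)
(* answers; the verdict may.                                                 *)
Definition nonadaptive (R : realFieldType) (n : nat) (A : rand_alg R n) :
    Prop :=
  forall (w : seed A) (f g : boolfun n), queries (run w) f = queries (run w) g.

(* Worst case over the random seed and the unknown function. *)
Definition query_bound (R : realFieldType) (n : nat) (A : rand_alg R n)
    (B : R) : Prop :=
  forall (w : seed A) (f : boolfun n), (size (queries (run w) f))%:R <= B.

(* Main.v *)
(* All but an eps/2 fraction of the cube lies in the middle layers
   | 2|x| - n | <= k with k = O(sqrt (n log (1/eps))), and a set in the middle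
   layers has at most (n+1)^k subsets there, so that all of them can be queried.
   For intersecting: sample x and look for a y in the middle layers with
   y \subset ~: x and f x = f y = 1. Erasing from f all points x that have such
   a witness, and everything off the middle layers, leaves an intersecting
   function, so if f is eps-far then a random x has a witness with probability
   at least eps/2. For union-closed: sample z and reject if f z = 0 while z is
   the union of those of its middle-layer subsets on which f = 1. The union
   closure of the middle part of f differs from f only at such z and off the
   middle layers. In both cases O(1/eps) samples suffice. For eps > 1/2 nothing
   is eps-far. *)

Require Import Defs.
From HB Require Import structures.
From mathcomp Require Import all_boot all_order all_algebra.
From mathcomp Require Import reals sequences exp.
From mathcomp Require Import zify ring lra.
Set Implicit Arguments.
Unset Strict Implicit.
Unset Printing Implicit Defensive.
Import Order.TTheory GRing.Theory Num.Theory.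
Local Open Scope ring_scope.

(** * Query trees whose queries are fixed in advance *)

Fixpoint batch (X : Type) (s : seq X) (v : seq bool -> bool) : query_tree X :=
  match s with
  | [::] => Halt (v [::])
  | x :: s' => Query x (fun b => batch s' (fun l => v (b :: l)))
  end.

Lemma queries_batch (X : Type) (s : seq X) v f : queries (batch s v) f = s.
Proof. by elim: s v => //= x s IHs v; rewrite IHs. Qed.

Lemma verdict_batch (X : Type) (s : seq X) v f :
  verdict (batch s v) f = v (map f s).
Proof. by elim: s v => //= x s IHs v; rewrite IHs. Qed.

(** Repeated points in [s] are harmless: [index] picks the first occurrence, and every occurrence
    gets the same answer. *)
Definition answers (X : eqType) (s : seq X) (l : seq bool) (x : X) : bool :=
  nth false l (index x s).

Lemma answersE (X : eqType) (s : seq X) (f : X -> bool) :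
  {in s, answers s (map f s) =1 f}.
Proof.
move=> x xs; rewrite /answers (nth_map x) ?index_mem //.
by rewrite nth_index.
Qed.

Lemma card_cube (n : nat) : #|{: {set 'I_n}}| = (2 ^ n)%N.
Proof. by rewrite -cardsT -powersetT card_powerset cardsT card_ord. Qed.

(** * Testers that inspect independent uniform samples *)

Section SamplingTester.
Variables (R : realFieldType) (n m : nat).
(** [bad f x] means that the sample [x] exposes a violation; [Q x] lists the points where [f] is
    read to decide this. *)
Variables (bad : boolfun n -> cube n -> bool) (Q : cube n -> seq (cube n)).

Let samples := {ffun 'I_m -> {set 'I_n}}.

Definition sampled_queries (w : samples) : seq {set 'I_n} :=
  flatten [seq Q (w i) | i <- enum 'I_m].

Definition sampling_run (w : samples) : query_tree (cube n) :=
  batch (sampled_queries w) (fun l =>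
    [forall i, ~~ bad (answers (sampled_queries w) l) (w i)]).

Lemma sampling_weight_ge0 (w : samples) : 0 <= (#|{: samples}|%:R : R)^-1.
Proof. by rewrite invr_ge0. Qed.

Lemma sampling_weight_sum1 :
  \sum_(w : samples) (#|{: samples}|%:R : R)^-1 = 1.
Proof.
rewrite sumr_const -[_^-1 *+ _]mulr_natl mulfV // pnatr_eq0.
by rewrite card_ffun card_cube !expn_eq0.
Qed.

Definition sampling_alg : rand_alg R n :=
  RandAlg sampling_weight_ge0 sampling_weight_sum1 sampling_run.

Hypothesis bad_local :
  forall x f g, {in Q x, f =1 g} -> bad f x = bad g x.

Lemma sampling_verdict (w : samples) f :
  verdict (sampling_run w) f = [forall i, ~~ bad f (w i)].
Proof.
rewrite verdict_batch; apply: eq_forallb => i; congr (~~ _).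
apply: bad_local => x xQ; apply: answersE.
by apply/flatten_mapP; exists i; rewrite ?mem_enum.
Qed.

Lemma sampling_nonadaptive : nonadaptive sampling_alg.
Proof. by move=> w f g; rewrite /= !queries_batch. Qed.

Lemma sampling_query_bound B :
  (forall x, (size (Q x) <= B)%N) -> query_bound sampling_alg (m * B)%:R.
Proof.
move=> szQ w f; rewrite /= queries_batch ler_nat size_flatten /shape -map_comp.
rewrite sumnE big_map -[in leqRHS](card_ord m) cardE.
elim: (enum _) => [|i s IHs]; first by rewrite big_nil.
by rewrite big_cons mulSn leq_add /=.
Qed.

Lemma sampling_accept1 f :
  (forall x, ~~ bad f x) -> pr_accept sampling_alg f = 1.
Proof.
move=> nbad; rewrite /pr_accept -[RHS]sampling_weight_sum1 /=.
by apply: eq_bigl => w; rewrite sampling_verdict; apply/forallP.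
Qed.

Lemma pr_reject_accept (A : rand_alg R n) f : pr_reject A f = 1 - pr_accept A f.
Proof.
apply/eqP; rewrite eq_sym subr_eq addrC; apply/eqP.
by rewrite -(weight_sum1 A) (bigID (fun w => verdict (run w) f)).
Qed.

Lemma sampling_pr_accept f :
  pr_accept sampling_alg f
  = (1 - #|[set x : {set 'I_n} | bad f x]|%:R / (2 ^ n)%:R) ^+ m.
Proof.
(* The accepting seeds are the functions with all values outside the bad set, so their number is an
   [m]-th power. *)
rewrite /pr_accept /= (eq_bigl (mem (ffun_on (predC (bad f))))); last first.
  by move=> w; rewrite sampling_verdict; apply: eq_forallb.
rewrite sumr_const card_ffun_on -[_^-1 *+ _]mulr_natl card_ffun !card_ord.
have N0 : (2 ^ n)%:R != 0 :> R by rewrite pnatr_eq0 expn_eq0.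
rewrite card_cube !natrX -exprVn -exprMn; congr (_ ^+ _).
rewrite -natrX -[X in X - _](divff N0) -mulrBl; congr (_ / _).
by rewrite -card_cube -(cardC (bad f)) cardsE natrD addrAC subrr add0r.
Qed.

(** With [q >= d] the density of bad points, all samples miss them with probability at most
    [1 / (1 + q * m) <= 1 / 3]. *)
Lemma sampling_reject f (d : R) :
  0 <= d -> 2 <= d * m%:R ->
  d <= #|[set x : {set 'I_n} | bad f x]|%:R / (2 ^ n)%:R ->
  2 / 3 <= pr_reject sampling_alg f.
Proof.
move=> d0 dm dbad; rewrite pr_reject_accept sampling_pr_accept.
set q := _ / _ in dbad *.
have q0 : 0 <= q by rewrite divr_ge0.
have q1 : q <= 1.
  rewrite ler_pdivrMr ?ltr0n ?expn_gt0 // mul1r ler_nat.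
  by rewrite (leq_trans (max_card _)) ?card_cube.
(* Bernoulli: [(1 - q)^m (1 + m q) <= ((1 - q) (1 + q))^m <= 1] *)
have dm3 : 3 <= (1 + q) ^+ m.
  apply: le_trans (_ : 1 + q * m%:R <= _).
    by rewrite -lerBlDl; apply: le_trans (ler_wpM2r _ dbad) => //; lra.
  elim: m => [|k IHk]; first by rewrite mulr0 addr0 expr0.
  rewrite exprSr; apply: le_trans (ler_wpM2r _ IHk); last by lra.
  rewrite -natr1; have := ler0n R k; nra.
have : (1 - q) ^+ m * (1 + q) ^+ m <= 1.
  rewrite -exprMn; apply: exprn_ile1; nra.
have : 0 <= (1 - q) ^+ m by apply: exprn_ge0; lra.
nra.
Qed.

End SamplingTester.

(** For far [f] the bad points have density at least [eps / 2], so [4 <= eps * m] makes at least 2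
    bad samples expected. *)
Lemma sampling_tester (R : realFieldType) (n m B : nat) (eps : R)
    (P : boolfun n -> Prop) (bad : boolfun n -> cube n -> bool)
    (Q : cube n -> seq (cube n)) :
  0 <= eps -> 4 <= eps * m%:R ->
  (forall x f g, {in Q x, f =1 g} -> bad f x = bad g x) ->
  (forall x, (size (Q x) <= B)%N) ->
  (forall f, P f -> forall x, ~~ bad f x) ->
  (forall f, far eps P f ->
     eps / 2 <= #|[set x : {set 'I_n} | bad f x]|%:R / (2 ^ n)%:R) ->
  exists A : rand_alg R n,
    [/\ nonadaptive A, one_sided P A, tester eps P A
      & query_bound A (m * B)%:R].
Proof.
move=> eps0 epsm Qloc szQ compl sound; exists (sampling_alg R m bad Q).
have acc1 f : P f -> pr_accept (sampling_alg R m bad Q) f = 1.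
  by move=> Pf; apply: sampling_accept1 => //; apply: compl.
split=> //.
- exact: sampling_nonadaptive.
- split=> f Pf; first by rewrite acc1 //; lra.
  by apply: (sampling_reject Qloc _ _ (sound f Pf)); lra.
- exact: sampling_query_bound.
Qed.

Lemma accepting_tester (R : realFieldType) (n : nat) (eps : R)
    (P : boolfun n -> Prop) :
  (forall f, ~ far eps P f) ->
  exists A : rand_alg R n,
    [/\ nonadaptive A, one_sided P A, tester eps P A & query_bound A 0].
Proof.
move=> nfar.
have w1 : \sum_(w : unit) (1 : R) = 1 by rewrite sumr_const card_unit.
exists (RandAlg (fun _ : unit => ler01) w1 (fun _ => Halt true)).
have acc f : pr_accept (RandAlg (fun _ : unit => ler01) w1
    (fun _ => @Halt (cube n) true)) f = 1 by rewrite /pr_accept /= w1.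
split=> //; split=> f; first by rewrite acc; lra.
by move/nfar.
Qed.

(** * Exponential tail bound for the size of a random set *)

Lemma exp_two_point_le (R : realType) (l : R) : 0 <= l <= 1 / 2 ->
  expR l + expR (- l) <= 2 * expR (2 * l ^+ 2).
Proof.
move=> /andP[l0 l1].
have em : 1 - l <= expR (- l) by have := expR_ge1Dx (- l); lra.
have ep : 1 + l <= expR l by exact: expR_ge1Dx.
have e2 : 1 + 2 * l ^+ 2 <= expR (2 * l ^+ 2) by exact: expR_ge1Dx.
have prod1 : expR l * expR (- l) = 1 by rewrite -expRD subrr expR0.
have p0 := expR_gt0 l; have m0 := expR_gt0 (- l).
(* Inverting the linear lower bounds avoids power series; the exponent [2 * l ^+ 2] is weaker than
   the optimal [l ^+ 2 / 2], but suffices. *)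
have up : expR l <= 1 / (1 - l) by rewrite ler_pdivlMr; [nra | lra].
have um : expR (- l) <= 1 / (1 + l) by rewrite ler_pdivlMr; [nra | lra].
apply: le_trans (lerD up um) _.
have -> : 1 / (1 - l) + 1 / (1 + l) = 2 / (1 - l ^+ 2).
  by field; do ?[apply/andP; split]; apply/eqP; nra.
apply: le_trans (_ : 2 * (1 + 2 * l ^+ 2) <= _); last by lra.
have l2 : l ^+ 2 <= 1 / 4 by nra.
have l2' : 0 <= l ^+ 2 by exact: sqr_ge0.
by rewrite ler_pdivrMr; nra.
Qed.

(** Expanding [n] factors [a + b] picks [a] on [x] and [b] off [x]. At [expR l] and [expR (- l)]
    this is an exponential moment of [#|x| - #|~: x|], up to the factor [2 ^ n]. *)
Lemma sum_expn_card (R : comNzRingType) (n : nat) (a b : R) :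
  \sum_(x : {set 'I_n}) a ^+ #|x| * b ^+ #|~: x| = (a + b) ^+ n.
Proof.
transitivity (\prod_(i < n) (a + b)); last by rewrite prodr_const card_ord.
rewrite (bigA_distr 1 _ (fun=> a) (fun=> b)).
apply: eq_bigr => x _; rewrite (bigID (mem x)) /=; congr (_ * _).
  by rewrite -prodr_const; apply: eq_bigr => i ->.
rewrite -prodr_const; by apply: eq_big => i; rewrite inE // => /negbTE->.
Qed.

Lemma upper_tail (R : realType) (n : nat) (s : R) : (0 < n)%N -> 0 <= s ->
  #|[set x : {set 'I_n} | n%:R + s <= (2 * #|x|)%:R]|%:R
    <= (2 ^ n)%:R * expR (- (s ^+ 2 / (8 * n%:R))).
Proof.
move=> n0 s0; have n0R : 0 < n%:R :> R by rewrite ltr0n.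
(* Beyond [n] the set is empty; otherwise the exponent [l] chosen below stays in the range of
   [exp_two_point_le]. *)
have [sn|ns] := leP s n%:R; last first.
  rewrite (_ : [set x | _] = set0) ?cards0 ?mulr_ge0 ?expR_ge0 //.
  apply/setP => x; rewrite !inE; apply/negbTE; rewrite -ltNge.
  have : (#|x| <= n)%N by rewrite -[leqRHS]card_ord max_card.
  by rewrite natrM -(ler_nat R); lra.
(* Chernoff's method with exponent [l], optimal for [2 n l^2 - l s]. *)
pose l : R := s / (4 * n%:R).
have l0 : 0 <= l by rewrite divr_ge0 // mulr_ge0 ?ltW.
have ln : l * (4 * n%:R) = s by rewrite mulfVK // mulf_neq0 // lt0r_neq0.
have l1 : l <= 1 / 2 by nra.
have -> : s ^+ 2 / (8 * n%:R) = l * s - n%:R * (2 * l ^+ 2).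
  by rewrite -ln; field; rewrite lt0r_neq0.
rewrite opprB expRD expRN mulrA ler_pdivlMr ?expR_gt0 //.
rewrite expRM_natl natrX -exprMn.
apply: le_trans (_ : (expR l + expR (- l)) ^+ n <= _); last first.
  by rewrite lerXn2r ?nnegrE ?addr_ge0 ?mulr_ge0 ?expR_ge0 //
    exp_two_point_le // l0.
(* Markov's inequality: drop the terms outside the tail; each remaining one is at least
   [expR (l * s)]. *)
rewrite -sum_expn_card [leRHS](bigID (mem [set x : {set 'I_n} |
  n%:R + s <= (2 * #|x|)%:R])) /=.
rewrite -[leLHS]addr0 lerD //; last first.
  by apply: sumr_ge0 => x _; rewrite mulr_ge0 ?exprn_ge0 ?expR_ge0.
rewrite mulr_natl -sumr_const; apply: ler_sum => x; rewrite inE => sx.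
rewrite -!expRM_natl -expRD ler_expR.
have := cardsC x; rewrite card_ord => /(congr1 (fun k => k%:R : R)).
move: sx; rewrite natrD natrM; set a := #|x|%:R; set b := #|~: x|%:R.
move=> sx abn; have -> : a * l + b * - l = (a - b) * l by ring.
by rewrite mulrC ler_wpM2r //; lra.
Qed.

(** * Middle layers: their mass and their subsets *)

Definition middle (n k : nat) (x : {set 'I_n}) : bool :=
  (n <= 2 * #|x| + k)%N && (2 * #|x| <= n + k)%N.

Lemma middleC (n k : nat) (x : {set 'I_n}) : middle k (~: x) = middle k x.
Proof. by have := cardsC x; rewrite card_ord /middle; lia. Qed.

(** Complementation carries the lower tail to the upper one. By integrality, off the middle
    [2 * #|x|] is at least [k.+1] away from [n], which leaves room for a real [s] up to [k.+1]. *)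
Lemma off_middle (R : realType) (n k : nat) (s : R) :
  (0 < n)%N -> 0 <= s <= k.+1%:R ->
  #|[set x : {set 'I_n} | ~~ middle k x]|%:R
    <= 2 * (2 ^ n)%:R * expR (- (s ^+ 2 / (8 * n%:R))).
Proof.
move=> n0 /andP[s0 sk].
pose T := [set x : {set 'I_n} | n%:R + s <= (2 * #|x|)%:R].
have subT : [set x | ~~ middle k x] \subset T :|: [set ~: x | x in T].
  have far_above (x : {set 'I_n}) : (n + k.+1 <= 2 * #|x|)%N -> x \in T.
    move=> nk; rewrite inE (le_trans (_ : _ <= (n + k.+1)%:R)) ?ler_nat //.
    by rewrite natrD lerD2l.
  apply/subsetP => x; rewrite !inE negb_and -!ltnNge => /orP[lo|hi].
    apply/orP; right; apply/imsetP; exists (~: x); rewrite ?setCK //.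
    by apply: far_above; have := cardsC x; rewrite card_ord; lia.
  by have := far_above x; rewrite inE => -> //; lia.
have cardT : (#|[set x : {set 'I_n} | ~~ middle k x]| <= 2 * #|T|)%N.
  apply: leq_trans (subset_leq_card subT) _.
  apply: leq_trans (leq_card_setU _ _) _.
  by rewrite mul2n -addnn leq_add2l leq_imset_card.
apply: le_trans (_ : (2 * #|T|)%:R <= _); first by rewrite ler_nat.
by rewrite natrM -mulrA ler_pM2l ?ltr0n // upper_tail.
Qed.

(** Such a set is the range of a map from ['I_k], with [None] as padding. *)
Lemma card_small_sets (n k : nat) :
  (#|[set D : {set 'I_n} | (#|D| <= k)%N]| <= n.+1 ^ k)%N.
Proof.
pose img (g : {ffun 'I_k -> option 'I_n}) := [set i | Some i \in codom g].
have -> : (n.+1 ^ k = #|{: {ffun 'I_k -> option 'I_n}}|)%N.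
  by rewrite card_ffun card_option !card_ord.
apply: leq_trans (leq_imset_card img _); apply: subset_leq_card.
apply/subsetP => D; rewrite inE => Dk.
apply/imsetP; exists [ffun j : 'I_k => nth None (map Some (enum D)) j] => //.
apply/setP => i; rewrite inE -mem_enum; apply/idP/codomP => [iD|[j]].
  have ik : (index i (enum D) < k)%N.
    by rewrite (leq_trans _ Dk) // cardE index_mem.
  exists (Ordinal ik); rewrite ffunE /= (nth_map i) ?index_mem //.
  by rewrite nth_index.
rewrite ffunE; have [jD|Dj] := ltnP j (size (enum D)).
  by rewrite (nth_map i) // => -[->]; rewrite mem_nth.
by rewrite nth_default ?size_map.
Qed.

Definition below (n k : nat) (z : {set 'I_n}) : {set {set 'I_n}} :=
  [set y : {set 'I_n} | (y \subset z) && middle k y].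

(** A set [y] below [z] is determined by [z :\: y], whose size is at most
    [((n + k) - (n - k)) / 2 = k]. *)
Lemma card_below (n k : nat) (z : {set 'I_n}) : middle k z ->
  (#|below k z| <= n.+1 ^ k)%N.
Proof.
move=> /andP[_ zk]; apply: leq_trans (card_small_sets n k).
have /card_in_imset <- :
    {in below k z &, injective (fun y : {set 'I_n} => z :\: y)}.
  move=> x y; rewrite !inE => /andP[xz _] /andP[yz _] zxy.
  by rewrite -(setIidPr xz) -(setIidPr yz) -[LHS]set0U -(setDv z) -setDDr zxy
    setDDr setDv set0U.
apply: subset_leq_card; apply/subsetP => _ /imsetP[y yB ->].
move: yB; rewrite !inE => /andP[yz /andP[yk _]].
by rewrite cardsD (setIidPr yz); lia.
Qed.

(** Nothing is read off the middle layers, where no point counts as bad. The set [z] is [~: x] for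
    intersecting and [x] for union-closed. *)
Definition local_queries (n k : nat) (x z : {set 'I_n}) : seq {set 'I_n} :=
  if middle k z then x :: enum (below k z) else [::].

Lemma size_local_queries (n k : nat) (x z : {set 'I_n}) :
  (size (local_queries k x z) <= (minn (2 ^ n) (n.+1 ^ k)).+1)%N.
Proof.
rewrite /local_queries; case: ifP => //= zk; rewrite -cardE ltnS leq_min.
by rewrite card_below // -card_cube max_card.
Qed.
(** Half of the distance [eps] is spent on the points off the middle; the other half must come from
    bad points. *)
Lemma dist_le_bad (R : realFieldType) (n k : nat) (eps : R)
    (f g : boolfun n) (bad : {set 'I_n} -> bool) :
  #|[set x : {set 'I_n} | ~~ middle k x]|%:R <= (2 ^ n)%:R * (eps / 2) ->
  (forall x, f x != g x -> middle k x -> bad x) ->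
  eps <= dist R f g ->
  eps / 2 <= #|[set x : {set 'I_n} | bad x]|%:R / (2 ^ n)%:R.
Proof.
move=> off fg_bad; have N0 : 0 < (2 ^ n)%:R :> R by rewrite ltr0n expn_gt0.
rewrite /dist !ler_pdivlMr // => far_fg.
have : (#|[set x : {set 'I_n} | f x != g x]| <=
    #|[set x : {set 'I_n} | ~~ middle k x]| + #|[set x | bad x]|)%N.
  apply: leq_trans (_ : #|_ :|: _| <= _)%N; last exact: leq_card_setU.
  apply: subset_leq_card.
  apply/subsetP => x; rewrite !inE => /fg_bad fgx.
  by case: (middle k x) fgx => //= ->.
by rewrite -(ler_nat R) natrD; lra.
Qed.

(** * Intersecting functions *)

Definition disjoint_bad (n k : nat) (f : boolfun n) (x : {set 'I_n}) : bool :=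
  [&& middle k x, f x & [exists y in below k (~: x), f y]].

Lemma disjoint_bad_local (n k : nat) (x : {set 'I_n}) (f g : boolfun n) :
  {in local_queries k x (~: x), f =1 g} ->
  disjoint_bad k f x = disjoint_bad k g x.
Proof.
rewrite /local_queries /disjoint_bad middleC; case: (middle k x) => //= fg.
rewrite fg ?mem_head //; congr (_ && _); apply: eq_existsb => y.
case yB: (y \in below _ _) => //=; apply: fg.
by rewrite in_cons mem_enum yB orbT.
Qed.

Lemma intersecting_disjoint_bad (n k : nat) (f : boolfun n) :
  intersecting f -> forall x, ~~ disjoint_bad k f x.
Proof.
move=> If x; apply/negP => /and3P[_ fx /exists_inP[y]].
rewrite inE => /andP[/subsetP yx _] fy.
by have [i [ix /yx]] := If _ _ fx fy; rewrite inE ix.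
Qed.

(** If [g] kept two disjoint points [x] and [y], then [y] would lie below [~: x] and [x] would have
    been erased. *)
Lemma far_disjoint_bad (R : realFieldType) (n k : nat) (eps : R)
    (f : boolfun n) :
  #|[set x : {set 'I_n} | ~~ middle k x]|%:R <= (2 ^ n)%:R * (eps / 2) ->
  far eps (@intersecting n) f ->
  eps / 2 <= #|[set x : {set 'I_n} | disjoint_bad k f x]|%:R / (2 ^ n)%:R.
Proof.
move=> off farf.
pose g (x : cube n) := [&& f x, middle k x & ~~ disjoint_bad k f x].
have /farf : intersecting g.
  move=> x y /and3P[fx mx nbad] /and3P[fy my _].
  have [/pred0P xy0|/pred0Pn[i /andP[ix iy]]] := boolP [disjoint x & y].
    case/negP: nbad; rewrite /disjoint_bad mx fx.
    apply/exists_inP; exists y => //.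
    rewrite inE my andbT; apply/subsetP => i iy; rewrite inE.
    by have := xy0 i; rewrite /= iy andbT => ->.
  by exists i.
apply: dist_le_bad off _ => x fg mx; apply: contraNT fg => nbad.
by rewrite /g mx nbad !andbT.
Qed.

(** * Union-closed functions *)

Definition generators (n k : nat) (f : boolfun n) (z : {set 'I_n}) :
    {set {set 'I_n}} := [set y in below k z | f y].

(* A nonempty union: otherwise the empty set would be generated by nothing. *)
Definition generated (n k : nat) (f : boolfun n) (z : {set 'I_n}) : bool :=
  (generators k f z != set0) && (cover (generators k f z) == z).

Definition union_bad (n k : nat) (f : boolfun n) (z : {set 'I_n}) : bool :=
  [&& middle k z, ~~ f z & generated k f z].

Lemma union_bad_local (n k : nat) (z : {set 'I_n}) (f g : boolfun n) :
  {in local_queries k z z, f =1 g} -> union_bad k f z = union_bad k g z.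
Proof.
rewrite /local_queries /union_bad; case: (middle k z) => //= fg.
rewrite fg ?mem_head // /generated.
suff -> : generators k f z = generators k g z by [].
apply/setP => y; rewrite !inE; case yB: (_ && middle k y) => //=; apply: fg.
by rewrite in_cons mem_enum inE yB orbT.
Qed.

Lemma union_closed_cover (n : nat) (f : boolfun n) (S : {set {set 'I_n}}) :
  union_closed f -> {in S, forall y, f y} -> S != set0 -> f (cover S).
Proof.
move=> Uf fS /set0Pn[A AS]; rewrite /cover (bigD1 A) //=.
(* The invariant carries a fixed member [A], since [f] may vanish at the empty union. *)
apply: (big_ind (fun X => f (A :|: X))).
- by rewrite setU0 fS.
- by move=> X Y fX fY; rewrite -(setUid A) setUACA; apply: Uf.
- by move=> y /andP[yS _]; apply: Uf; apply: fS.
Qed.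

Lemma union_closed_union_bad (n k : nat) (f : boolfun n) :
  union_closed f -> forall z, ~~ union_bad k f z.
Proof.
move=> Uf z; apply/negP => /and3P[_ nfz /andP[gen0 /eqP genz]].
case/negP: nfz; rewrite -genz; apply: union_closed_cover => // y.
by rewrite inE => /andP[].
Qed.

Lemma cover_generators_sub (n k : nat) (f : boolfun n) (z : {set 'I_n}) :
  cover (generators k f z) \subset z.
Proof. by apply/bigcupsP => y; rewrite !inE => /andP[/andP[]]. Qed.

(** Generators are monotone in the set, so those of [x :|: y] already cover [x] and [y]. *)
Lemma generated_union_closed (n k : nat) (f : boolfun n) :
  union_closed (generated k f : boolfun n).
Proof.
have gensS (x z : {set 'I_n}) : x \subset z ->
    generators k f x \subset generators k f z.
  move=> xz; apply/subsetP => y; rewrite !inE => /andP[/andP[yx ->] ->].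
  by rewrite (subset_trans yx xz).
have coverS (x z : {set 'I_n}) : x \subset z -> generated k f x ->
    x \subset cover (generators k f z).
  move=> xz /andP[_ /eqP {1}<-]; apply/bigcupsP => y /(subsetP (gensS _ _ xz)).
  exact: bigcup_sup.
move=> x y gx gy; apply/andP; split.
  case/andP: (gx) => /set0Pn[A /(subsetP (gensS _ _ (subsetUl x y))) AS] _.
  by apply/set0Pn; exists A.
rewrite eqEsubset cover_generators_sub subUset.
by rewrite !coverS ?subsetUl ?subsetUr.
Qed.

Lemma far_union_bad (R : realFieldType) (n k : nat) (eps : R)
    (f : boolfun n) :
  #|[set x : {set 'I_n} | ~~ middle k x]|%:R <= (2 ^ n)%:R * (eps / 2) ->
  far eps (@union_closed n) f ->
  eps / 2 <= #|[set x : {set 'I_n} | union_bad k f x]|%:R / (2 ^ n)%:R.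
Proof.
move=> off /(_ _ (@generated_union_closed n k f)).
apply: dist_le_bad off _ => z fg mz; rewrite /union_bad mz /=.
case fz: (f z) fg => /= [|]; last by case: (generated k f z).
suff -> : generated k f z by [].
(* A middle [z] with [f z] generates itself, so on the middle the closure only adds points. *)
have zS : z \in generators k f z by rewrite !inE subxx mz fz.
apply/andP; split; first by apply/set0Pn; exists z.
by rewrite eqEsubset cover_generators_sub bigcup_sup.
Qed.

(** * No function is more than 1/2 away from either property *)

Lemma intersecting_not_far (R : realFieldType) (n : nat) (eps : R) :
  (0 < n)%N -> 1 / 2 < eps -> forall f, ~ far eps (@intersecting n) f.
Proof.
case: n => // n _ eps2 f.
(* Keeping only sets through one fixed coordinate alters [f] on at most half of the cube. *)
pose g (x : cube n.+1) := f x && (ord0 \in x).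
have /[swap]/[apply] : intersecting g.
  by move=> x y /andP[_ x0] /andP[_ y0]; exists ord0.
have N0 : 0 < (2 ^ n.+1)%:R :> R by rewrite ltr0n expn_gt0.
rewrite /dist ler_pdivlMr // leNgt => /negP; apply.
apply: le_lt_trans (_ : (2 ^ n)%:R < _); last first.
  by move: N0; rewrite expnS natrM; nra.
have <- : #|powerset [set~ (ord0 : 'I_n.+1)]| = (2 ^ n)%N.
  by rewrite card_powerset cardsC1 card_ord.
rewrite ler_nat; apply: subset_leq_card; apply/subsetP => x.
rewrite !inE /g => fgx; apply/subsetP => i ix; rewrite !inE.
by apply: contraNneq fgx => i0; rewrite -i0 ix andbT eqxx.
Qed.

(** Both constants are union-closed and their distances from [f] add up to 1. *)
Lemma union_closed_not_far (R : realFieldType) (n : nat) (eps : R) :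
  1 / 2 < eps -> forall f, ~ far eps (@union_closed n) f.
Proof.
move=> eps2 f farf; have N0 : 0 < (2 ^ n)%:R :> R by rewrite ltr0n expn_gt0.
have true_far : eps <= dist R f (fun=> true) by exact: farf.
have false_far : eps <= dist R f (fun=> false) by exact: farf.
move: true_far false_far; rewrite /dist !ler_pdivlMr //.
set A := [set _ | _]; set B := [set _ | _].
have /(congr1 (fun k => k%:R : R)) := cardsC A.
have -> : ~: A = B by apply/setP => x; rewrite !inE; case: (f x).
by rewrite card_cube natrD; nra.
Qed.

(** * Choice of the width [k] and the final query count *)

Lemma expnS_le_expn_mul2 (n k : nat) : (1 < n)%N ->
  (n.+1 ^ k <= n ^ (2 * k))%N.
Proof.
case: k => // k n1; rewrite expnM leq_exp2r // -mulnn.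
by nia.
Qed.

Lemma middle_parameter (R : realType) (n : nat) (eps : R) :
  (0 < n)%N -> 0 < eps <= 1 / 2 ->
  exists k : nat,
    #|[set x : {set 'I_n} | ~~ middle k x]|%:R <= (2 ^ n)%:R * (eps / 2) /\
    (minn (2 ^ n) (n.+1 ^ k))%:R
      <= 2 * (n%:R `^ Num.sqrt (n%:R * ln (1 / eps))) ^+ 10.
Proof.
move=> n0 /andP[eps0 eps2]; have n0R : 0 < n%:R :> R by rewrite ltr0n.
set L := Num.sqrt _; set e1 := 1 / eps in L *.
have e1eps : e1 * eps = 1 by rewrite mulfVK ?lt0r_neq0.
have e12 : 2 <= e1 by nra.
have ln1 : 0 <= ln e1 by rewrite ln_ge0 //; lra.
(* This rests on [eps <= 1 / 2], that is [4 <= e1 ^+ 2]; near [eps = 1] no constant would do. *)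
have ln4 : ln (4 * e1) <= 3 * ln e1.
  rewrite [3 * _]mulr_natl -lnXn; last by lra.
  have e13 : 4 * e1 <= e1 ^+ 3 by rewrite !exprS; nra.
  by rewrite ler_ln // posrE; lra.
have ln40 : 0 <= ln (4 * e1) by rewrite ln_ge0 //; lra.
(* Chosen so that the tail factor [expR (- (s ^+ 2 / (8 * n%:R)))] equals [eps / 4]. *)
pose s := Num.sqrt (8 * n%:R * ln (4 * e1)).
have s2 : s ^+ 2 = 8 * n%:R * ln (4 * e1) by rewrite sqr_sqrtr // !mulr_ge0.
have L2 : L ^+ 2 = n%:R * ln e1 by rewrite sqr_sqrtr // mulr_ge0.
have s0 : 0 <= s := sqrtr_ge0 _; have L0 : 0 <= L := sqrtr_ge0 _.
(* Indeed [s ^+ 2 <= 24 * L ^+ 2]. Hence [2 * k <= 10 * L] for [k = Num.truncn s], the source of the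
   power 10. *)
have sL : s <= 5 * L.
  rewrite -(@ler_pXn2r _ 2) ?nnegrE ?mulr_ge0 // exprMn s2 L2; nra.
have /andP[ks sk] := truncn_itv s0.
exists (Num.truncn s); split.
  apply: le_trans (off_middle n0 (s := s) _) _; first by rewrite s0 ltW.
  have -> : s ^+ 2 / (8 * n%:R) = ln (4 * e1).
    by rewrite s2; field; rewrite lt0r_neq0.
  rewrite expRN lnK ?posrE; last by lra.
  have -> : (4 * e1)^-1 = eps / 4 by rewrite /e1; field; rewrite lt0r_neq0.
  by have := ler0n R (2 ^ n); nra.
(* For n = 1 the power of n degenerates to 1: count all of the cube instead. *)
case: n n0 n0R @L @s s2 L2 s0 L0 sL ks sk => // -[|n] _ n0R L s s2 L2 s0 L0 sL
  ks sk.
  by rewrite powR1 expr1n mulr1 ler_nat expn1 geq_minl.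
have X0 : 0 <= (n.+2%:R `^ L) ^+ 10 by rewrite exprn_ge0 ?powR_ge0.
apply: le_trans (_ : (n.+2%:R `^ L) ^+ 10 <= _); last by lra.
apply: le_trans (_ : (n.+2 ^ (2 * Num.truncn s))%:R <= _).
  by rewrite ler_nat (leq_trans (geq_minr _ _)) ?expnS_le_expn_mul2.
rewrite -(powR_mulrn 10) ?powR_ge0 // -powRrM natrX -powR_mulrn //.
by apply: ler_powR; [rewrite ler1n | rewrite natrM; lra].
Qed.

Lemma layered_tester (R : realType) (P : forall n, boolfun n -> Prop)
    (bad : forall n, nat -> boolfun n -> {set 'I_n} -> bool)
    (top : forall n, {set 'I_n} -> {set 'I_n}) :
  (forall n k x f g, {in local_queries k x (top n x), f =1 g} ->
     bad n k f x = bad n k g x) ->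
  (forall n k f, P n f -> forall x, ~~ bad n k f x) ->
  (forall n k (eps : R) f,
     #|[set x : {set 'I_n} | ~~ middle k x]|%:R <= (2 ^ n)%:R * (eps / 2) ->
     far eps (P n) f ->
     eps / 2 <= #|[set x : {set 'I_n} | bad n k f x]|%:R / (2 ^ n)%:R) ->
  (forall n (eps : R), (0 < n)%N -> 1 / 2 < eps ->
     forall f, ~ far eps (P n) f) ->
  exists p : {poly {poly R}}, forall (n : nat) (eps : R),
    (1 <= n)%N -> 0 < eps < 1 ->
    exists A : rand_alg R n,
      [/\ nonadaptive A, one_sided (P n) A, tester eps (P n) A
        & query_bound A
            p.[n%:R `^ Num.sqrt (n%:R * ln (1 / eps)), 1 / eps]].
Proof.
(* The outer variable stands for the power of [n], the inner one for [1 / eps]. The factor 15 is 5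
   from the number of samples times 3 from the queries per sample. *)
move=> loc compl sound nfar; exists ((15 *: 'X)%:P * 'X^10).
move=> n eps n1 /andP[eps0 _].
rewrite hornerM hornerC hornerXn -polyC_exp hornerM hornerZ hornerX hornerC.
set X := _ `^ _.
have X1 : 1 <= X ^+ 10.
  rewrite exprn_ege1 // -(powRr0 n%:R) ler_powR ?ler1n ?sqrtr_ge0 //.
have e0 : 0 < 1 / eps by rewrite divr_gt0.
have [eps2|eps2] := ltP (1 / 2) eps.
  have [A [nA oA tA qA]] := accepting_tester (nfar n eps n1 eps2).
  exists A; split=> // w f; apply: le_trans (qA w f) _; nra.
have [|k [off cardk]] := middle_parameter (eps := eps) n1.
  by rewrite eps0.
rewrite -/X in cardk.
(* Rounding [4 / eps] down and taking one more sample gives [4 <= eps * m.+1%:R], with [m.+1] still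
   at most [5 / eps]. *)
have /andP[mle mgt] := truncn_itv (ltW (mulr_gt0 (ltr0n R 4) e0)).
set m := Num.truncn _ in mle mgt.
have epsV : eps * (1 / eps) = 1 by rewrite mulrC mulfVK ?lt0r_neq0.
have epsm : 4 <= eps * m.+1%:R by nra.
have [A [nA oA tA qA]] := sampling_tester (ltW eps0) epsm (loc n k)
  (fun x => size_local_queries k x (top n x)) (compl n k)
  (fun f => sound n k eps f off).
exists A; split=> // w f; apply: le_trans (qA w f) _.
rewrite natrM -natr1 -[X in _ * X <= _]natr1.
apply: le_trans (_ : (5 * (1 / eps)) * (3 * X ^+ 10) <= _); last by lra.
by apply: ler_pM; rewrite ?addr_ge0 //; nra.
Qed.

Theorem theorem1p1 (R : realType) :
  (exists p : {poly {poly R}}, forall (n : nat) (eps : R),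
     (1 <= n)%N -> 0 < eps < 1 ->
     exists A : rand_alg R n,
       [/\ nonadaptive A,
           one_sided (@intersecting n) A,
           tester eps (@intersecting n) A
         & query_bound A
             p.[n%:R `^ Num.sqrt (n%:R * ln (1 / eps)), 1 / eps]]) /\
  (exists p : {poly {poly R}}, forall (n : nat) (eps : R),
     (1 <= n)%N -> 0 < eps < 1 ->
     exists A : rand_alg R n,
       [/\ nonadaptive A,
           one_sided (@union_closed n) A,
           tester eps (@union_closed n) A
         & query_bound A
             p.[n%:R `^ Num.sqrt (n%:R * ln (1 / eps)), 1 / eps]]).
Proof.
split.
  apply: (layered_tester (bad := disjoint_bad) (top := fun n x => ~: x)).
  - exact: disjoint_bad_local.
  - exact: intersecting_disjoint_bad.
  - exact: far_disjoint_bad.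
  - exact: intersecting_not_far.
apply: (layered_tester (bad := union_bad) (top := fun n x => x)).
- exact: union_bad_local.
- exact: union_closed_union_bad.
- exact: far_union_bad.
- by move=> n eps _; exact: union_closed_not_far.
Qed.
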